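(* Let $L$ be a finite-dimensional Lie algebra over $\mathbb{F}$. Then the near perfect radical $NP(L)$ of $L$ is equal to the smallest ideal of the lower central series $L^0\supseteq L^1\supseteq L^2\supseteq\cdots$ of $L$.
   Context: $\mathbb{F}$ denotes either the field of real numbers or the field of complex numbers. An ideal $I$ of $L$ is called a near perfect ideal of $L$ if $[L,I]=I$, where $[L,I]$ is the linear span of all $[x,y]$ with $x\in L$, $y\in I$; the zero ideal is near perfect. The sum of two near perfect ideals is near perfect, so a finite-dimensional Lie algebra $L$ has a largest near perfect ideal (one containing all near perfect ideals of $L$); it is called the near perfect radical of $L$ and denoted $NP(L)$. The lower central series of $L$ is the descending sequence of ideals $L^0=L$, $L^{k+1}=[L,L^k]$; since $L$ is finite-dimensional it stabilizes, and its smallest ideal is its eventual constant value. *)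

(* Defs.v *)
From HB Require Import structures.
From mathcomp Require Import all_boot all_order all_algebra.
From mathcomp Require Import boolp classical_sets reals.

Set Implicit Arguments.
Unset Strict Implicit.
Unset Printing Implicit Defensive.

Import GRing.Theory.

Local Open Scope classical_set_scope.
Local Open Scope ring_scope.

(* The carrier is a [vectType], so these Lie algebras are finite-dimensional. *)
HB.mixin Record Vector_isLieAlgebra (F : fieldType) L of Vector F L := {
  lie : L -> L -> L;
  lie_linearl : forall y : L, linear (fun x => lie x y);
  lie_linearr : forall x : L, linear (lie x);
  liexx : forall x : L, lie x x = 0;
  lie_jacobi : forall x y z : L,
    lie x (lie y z) + lie y (lie z x) + lie z (lie x y) = 0
}.

#[short(type="lieAlgType")]
HB.structure Definition LieAlgebra (F : fieldType) :=
  {L of Vector F L & Vector_isLieAlgebra F L}.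

Section Span.

Variables (F : fieldType) (L : vectType F).
Implicit Types (A : set L) (P : set {vspace L}).

(* [<<s>>] only spans finite sequences; [lspan A] is the linear span of an
   arbitrary subset.  The default value [0%VS] is never used, see [lspanP]. *)
Definition is_lspan A (V : {vspace L}) : Prop :=
  forall v, v \in V <->
    exists2 s : seq L, (forall x, x \in s -> A x) & v \in <<s>>%VS.

Definition lspan A : {vspace L} := xget 0%VS [set V | is_lspan A V].

Lemma exists_max_dim P : P !=set0 ->
  exists2 V, P V & forall W, P W -> (\dim W <= \dim V)%N.
Proof.
move=> [V0 PV0].
have exP : exists n, `[< exists2 V, P V & \dim V = n >].
  by exists (\dim V0); apply/asboolP; exists V0.
have ubP n : `[< exists2 V, P V & \dim V = n >] -> (n <= \dim {:L})%N.
  by move=> /asboolP[V _ <-]; apply/dimvS/subvf.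
case: (ex_maxnP exP ubP) => m /asboolP[V PV <-] maxm.
by exists V => // W PW; apply: maxm; apply/asboolP; exists W.
Qed.

Lemma exists_min_dim P : P !=set0 ->
  exists2 V, P V & forall W, P W -> (\dim V <= \dim W)%N.
Proof.
move=> [V0 PV0].
have exP : exists n, `[< exists2 V, P V & \dim V = n >].
  by exists (\dim V0); apply/asboolP; exists V0.
case: (ex_minnP exP) => m /asboolP[V PV <-] minm.
by exists V => // W PW; apply: minm; apply/asboolP; exists W.
Qed.

Lemma lspanP A : is_lspan A (lspan A).
Proof.
suff exV : exists V, is_lspan A V by exact: (xgetPex 0%VS exV).
have [| V [s sA ->] maxV] := @exists_max_dim
  [set V | exists2 s : seq L, (forall x, x \in s -> A x) & V = <<s>>%VS].
  by exists <<[::]>>%VS, [::].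
exists <<s>>%VS => v; split=> [vs|[t tA vt]]; first by exists s.
have dst : (\dim <<s ++ t>> <= \dim <<s>>)%N.
  by apply: maxV; exists (s ++ t) => // x; rewrite mem_cat => /orP[/sA|/tA].
suff -> : <<s>>%VS = <<s ++ t>>%VS.
  by rewrite span_cat; apply: subvP vt; exact: addvSr.
by apply/eqP; rewrite eqEdim dst andbT span_cat addvSl.
Qed.

Lemma mem_lspan A x : A x -> x \in lspan A.
Proof.
move=> Ax; apply/lspanP; exists [:: x]; last by rewrite memv_span ?mem_head.
by move=> y; rewrite inE => /eqP->.
Qed.

Lemma lspan_subv A (V : {vspace L}) :
  (forall x, A x -> x \in V) -> (lspan A <= V)%VS.
Proof.
move=> AV; apply/subvP => v /lspanP[s sA]; apply/subvP/span_subvP => x /sA.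
exact: AV.
Qed.

End Span.

Section LieIdeals.

Variables (F : fieldType) (L : lieAlgType F).
Implicit Types U V W I J N M : {vspace L}.

Definition lie_ideal I : Prop := forall x y : L, y \in I -> lie x y \in I.

Definition liev U V : {vspace L} :=
  lspan [set z | exists x y : L, [/\ x \in U, y \in V & z = lie x y]].

Definition near_perfect I : Prop := lie_ideal I /\ liev fullv I = I.

Definition largest_near_perfect N : Prop :=
  near_perfect N /\ forall I, near_perfect I -> (I <= N)%VS.

(* The default value is never used, see [np_radicalP]. *)
Definition np_radical : {vspace L} :=
  xget 0%VS [set N | largest_near_perfect N].

Definition lower_central (k : nat) : {vspace L} := iter k (liev fullv) fullv.

Definition smallest_lower_central M : Prop :=
  (exists k, M = lower_central k) /\ forall k, (M <= lower_central k)%VS.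

(* The default value is never used, see [lower_central_endP]. *)
Definition lower_central_end : {vspace L} :=
  xget 0%VS [set M | smallest_lower_central M].

Lemma memv_lie U V x y : x \in U -> y \in V -> lie x y \in liev U V.
Proof. by move=> xU yV; apply: mem_lspan; exists x, y. Qed.

Lemma liev_subv U V W :
  (forall x y, x \in U -> y \in V -> lie x y \in W) -> (liev U V <= W)%VS.
Proof. by move=> h; apply: lspan_subv => _ [x [y [xU yV ->]]]; apply: h. Qed.

Lemma lievS U V W : (V <= W)%VS -> (liev U V <= liev U W)%VS.
Proof.
by move=> VW; apply: liev_subv => x y xU /(subvP VW); apply: memv_lie.
Qed.

Lemma lieDr (x y z : L) : lie x (y + z) = lie x y + lie x z.
Proof. by have := lie_linearr x 1 y z; rewrite !scale1r. Qed.

Lemma near_perfect0 : near_perfect 0%VS.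
Proof.
have h (x y : L) : y \in 0%VS -> lie x y \in (0%VS : {vspace L}).
  rewrite !memv0 => /eqP->; apply/eqP.
  by have := lieDr x 0 0; rewrite addr0 -{1}[lie x 0]addr0 => /addrI <-.
split=> //; apply/eqP; rewrite -subv0; apply: liev_subv => x y _; exact: h.
Qed.

Lemma near_perfectD I J :
  near_perfect I -> near_perfect J -> near_perfect (I + J)%VS.
Proof.
move=> [idI npI] [idJ npJ].
have idIJ : lie_ideal (I + J)%VS.
  move=> x _ /memv_addP[u uI [v vJ ->]].
  by rewrite lieDr memv_add ?idI ?idJ.
split=> //; apply: subv_anti; apply/andP; split.
  by apply: liev_subv => x y _; apply: idIJ.
by rewrite subv_add -{1}npI -{2}npJ !lievS ?addvSl ?addvSr.
Qed.

Lemma np_radicalP : largest_near_perfect np_radical.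
Proof.
suff exN : exists N, largest_near_perfect N by exact: (xgetPex 0%VS exN).
have [| N npN maxN] := @exists_max_dim _ _ [set N | near_perfect N].
  by exists 0%VS; apply: near_perfect0.
exists N; split=> // I npI.
suff -> : N = (N + I)%VS by exact: addvSr.
by apply/eqP; rewrite eqEdim addvSl maxN //; apply: near_perfectD.
Qed.

Lemma lower_centralS k : (lower_central k.+1 <= lower_central k)%VS.
Proof. by elim: k => [|k IHk]; [exact: subvf | exact: lievS]. Qed.

Lemma lower_central_le j k :
  (j <= k)%N -> (lower_central k <= lower_central j)%VS.
Proof.
move=> /subnK<-; elim: (k - j)%N => [|n IHn] //.
exact: subv_trans (lower_centralS _) IHn.
Qed.

Lemma lower_central_endP : smallest_lower_central lower_central_end.
Proof.
suff exM : exists M, smallest_lower_central M by exact: (xgetPex 0%VS exM).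
have [| M [k _ kM] minM] := @exists_min_dim _ _ (range lower_central).
  by exists (lower_central 0), 0.
exists M; split; first by exists k.
move=> j; suff -> : M = lower_central (maxn j k).
  by apply: lower_central_le; exact: leq_maxl.
apply/esym/eqP; rewrite eqEdim minM; last by exists (maxn j k).
by rewrite -kM lower_central_le ?leq_maxr.
Qed.

Lemma lower_central_ideal k : lie_ideal (lower_central k).
Proof.
case: k => [|k] x y; first by rewrite !memvf.
by move=> /(subvP (lower_centralS k)); apply: memv_lie; rewrite memvf.
Qed.

Lemma lower_central_stable :
  exists n, forall k, (n <= k)%N -> lower_central k = lower_central_end.
Proof.
have [[n ->] minM] := lower_central_endP; exists n => k nk.
by apply: subv_anti; rewrite minM lower_central_le.
Qed.

End LieIdeals.

Arguments np_radical {F} L.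
Arguments lower_central {F} L k.
Arguments lower_central_end {F} L.

(* Main.v *)
Require Import Defs.
From mathcomp Require Import all_boot all_order all_algebra reals complex.

(** The smallest term [M] of the lower central series is the value at which the
    series stabilizes, so bracketing with the whole algebra fixes it: it is near
    perfect, hence contained in the near perfect radical.  Conversely, a near
    perfect ideal [I] reproduces itself under bracketing with the whole algebra,
    an operation that is monotone; starting from the fact that [I] lies in the
    algebra, it therefore lies in every term of the series, in particular in
    [M].  The argument is uniform in the ground field, so the real and the
    complex case are both instances of [np_radicalE]. *)

Local Open Scope ring_scope.
Local Open Scope complex_scope.

Section NearPerfectRadical.

Variables (F : fieldType) (L : lieAlgType F).

(** Two consecutive terms beyond the point of stabilization both equal the
    smallest term, and the second is the bracket of the algebra with the
    first. *)
Lemma near_perfect_lower_central_end : near_perfect (lower_central_end L).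
Proof.
have [n stab] := lower_central_stable L.
split; first by rewrite -(stab n (leqnn n)); apply: lower_central_ideal.
by rewrite -{1}(stab n (leqnn n)) -(stab n.+1 (leqnSn n)).
Qed.

(** By induction on [k]: if [I] lies in the [k]-th term, then bracketing with
    the algebra sends [I] to itself and the [k]-th term to the next one. *)
Lemma near_perfect_sub_lower_central (I : {vspace L}) k :
  near_perfect I -> (I <= lower_central L k)%VS.
Proof.
move=> [_ npI]; elim: k => [|k IHk]; first exact: subvf.
by rewrite -npI; apply: lievS.
Qed.

Lemma np_radicalE : np_radical L = lower_central_end L.
Proof.
have [np_rad max_rad] := np_radicalP L.
have [[k endE] _] := lower_central_endP L.
apply: subv_anti; rewrite max_rad; last exact: near_perfect_lower_central_end.
by rewrite andbT endE near_perfect_sub_lower_central.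
Qed.

End NearPerfectRadical.

Theorem proposition3p3 (R : realType) :
  (forall L : lieAlgType R, np_radical L = lower_central_end L) /\
  (forall L : lieAlgType R[i], np_radical L = lower_central_end L).
Proof. by split=> L; apply: np_radicalE. Qed.
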